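(* In the noisy setting, there is a sequence $\epsilon_n\to0$ (depending on $\beta,P_X,P_{Y\mid X}$) such that for all $n$ \[ P^*_{\mathrm{error}}\le 2(1+\epsilon_n)\left\{\beta\wedge\frac1{I(Y;\tilde Y)}\right\}\frac{\log n}{n}, \] with the convention $1/0=\infty$.
   Context: Setting. Let $\mathcal X,\mathcal Y$ be finite alphabets; logarithms are to base $|\mathcal X|$. Let $\mathbf X=\{X_i\}_{i\in\mathbb Z}$ be a random process on $\mathcal X$. Fix $\beta>0$; let $\ell=\ell(n)=\beta\log n$ (rounded to an integer) and $n_\ell:=n-(2\ell-1)$. Let $I(1)\sim\mathrm{Uniform}[n]$ and, conditionally on $I(1)$, let $I(2)$ be uniform on $I(1)+\{-\ell+1,\dots,n-\ell\}$ if $1\le I(1)\le \ell-1$, uniform on $[n]$ if $\ell\le I(1)\le n-\ell+1$, and uniform on $I(1)+\{\ell-n,\dots,\ell-1\}$ if $n-\ell+2\le I(1)\le n$; $(I(1),I(2))$ is independent of $\mathbf X$. Noiseless reads: $X_1^\ell(j):=X_{I(j)}^{I(j)+\ell-1}$, $j=1,2$. Signed overlap: $T:=\max\{0,\ell-(I(2)-I(1))\}$ if $I(2)\ge I(1)$, $T:=-\max\{0,\ell-(I(1)-I(2))\}$ if $I(2)<I(1)$, with values in $\mathcal T:=\{-(\ell-1),\dots,0,\dots,\ell\}$, $\mathbb P[T=0]=n_\ell/n$, $\mathbb P[T=t]=1/n$ for $t\ne0$. Noisy reads $Y_1^\ell(j)\in\mathcal Y^\ell$ are drawn from a kernel $P_{Y_1^\ell\mid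 X_1^\ell}$ given $X_1^\ell(j)$, conditionally independently given the noiseless reads. A detector is any map $\hat T:\mathcal Y^\ell\times\mathcal Y^\ell\to\mathcal T$; $P_{\mathrm{error}}(\hat T):=\mathbb P[\hat T(Y_1^\ell(1),Y_1^\ell(2))\ne T]$, $P^*_{\mathrm{error}}:=\min_{\hat T}P_{\mathrm{error}}(\hat T)$. Noisy setting: $\mathbf X$ is i.i.d. with marginal p.m.f. $P_X$, and $P_{Y_1^\ell\mid X_1^\ell}(y_1^\ell\mid x_1^\ell)=\prod_{i=1}^\ell P_{Y\mid X}(y_i\mid x_i)$ for a fixed channel $P_{Y\mid X}$. Let $P_Y$ be the $Y$-marginal of $P_X\otimes P_{Y\mid X}$, and $P_{Y\tilde Y}(y,\tilde y):=\sum_xP_X(x)P_{Y\mid X}(y\mid x)P_{Y\mid X}(\tilde y\mid x)$ (two independent channel outputs of the same input); $I(Y;\tilde Y)$ is the mutual information under $P_{Y\tilde Y}$. *)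

(* Defs.v *)
From HB Require Import structures.
From mathcomp Require Import all_boot all_order all_algebra.
From mathcomp Require Import all_classical all_reals all_analysis.
Set Implicit Arguments. Unset Strict Implicit. Unset Printing Implicit Defensive.
Import Order.TTheory GRing.Theory Num.Theory.
Local Open Scope ring_scope.

Definition logb (R : realType) (b : nat) (x : R) : R := ln x / ln (b%:R).

Definition is_pmf (R : realType) (T : finType) (p : T -> R) : Prop :=
  (forall t, 0 <= p t) /\ \sum_(t : T) p t = 1.

Definition is_channel (R : realType) (A B : finType) (W : A -> B -> R) : Prop :=
  forall a, is_pmf (W a).

Definition PY (R : realType) (X Y : finType) (pX : X -> R) (W : X -> Y -> R)
  (y : Y) : R := \sum_(x : X) pX x * W x y.

(* two independent channel outputs of the same input *)
Definition PYY (R : realType) (X Y : finType) (pX : X -> R) (W : X -> Y -> R)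
  (y y' : Y) : R := \sum_(x : X) pX x * W x y * W x y'.

Definition mutinfo (R : realType) (X Y : finType) (b : nat) (pX : X -> R)
  (W : X -> Y -> R) : R :=
  \sum_(y : Y) \sum_(y' : Y)
    (if PYY pX W y y' == 0 then 0
     else PYY pX W y y' * logb b (PYY pX W y y' / (PY pX W y * PY pX W y'))).

Definition minfac (R : realType) (beta I : R) : R :=
  if I == 0 then beta else Num.min beta I^-1.

Definition overlap (l : nat) (i1 i2 : int) : int :=
  if i1 <= i2 then Num.max 0 (l%:Z - (i2 - i1))
  else - Num.max 0 (l%:Z - (i1 - i2)).

Definition I2_support (n l : nat) (i1 i2 : int) : bool :=
  if i1 <= l%:Z - 1 then (i1 - l%:Z + 1 <= i2) && (i2 <= i1 + n%:Z - l%:Z)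
  else if i1 <= n%:Z - l%:Z + 1 then (1 <= i2) && (i2 <= n%:Z)
  else (i1 + l%:Z - n%:Z <= i2) && (i2 <= i1 + l%:Z - 1).

Definition pI (R : realType) (n l : nat) (i1 i2 : int) : R :=
  if (1 <= i1) && (i1 <= n%:Z) && I2_support n l i1 i2
  then (n%:R)^-1 * (n%:R)^-1 else 0.

(* The i.i.d. process restricted to the window of positions
   p in [-l, n + 2l] (window index p + l), which contains every position
   read by either read. *)
Definition window (X : finType) (n l : nat) := {ffun 'I_(n + 3 * l).+1 -> X}.

Definition win_val (X : finType) (n l : nat) (x : window X n l) (p : int) : X :=
  x (inord (absz (p + l%:Z))).

Definition read (X : finType) (n l : nat) (x : window X n l) (i : int)
  : {ffun 'I_l -> X} :=
  [ffun k : 'I_l => win_val x (i + (k : nat)%:Z)].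

Definition pXn (R : realType) (X : finType) (n l : nat) (pX : X -> R)
  (x : window X n l) : R := \prod_(k : 'I_(n + 3 * l).+1) pX (x k).

Definition Wn (R : realType) (X Y : finType) (l : nat) (W : X -> Y -> R)
  (y : {ffun 'I_l -> Y}) (x : {ffun 'I_l -> X}) : R :=
  \prod_(k : 'I_l) W (x k) (y k).

Definition Tset (l : nat) (t : int) : bool :=
  ((1 - l%:Z <= t) && (t <= l%:Z)) || (t == 0).

Definition Tidx (l : nat) := {k : 'I_(2 * l).+1 | Tset l ((k : nat)%:Z - l%:Z)}.

Definition tval (l : nat) (t : Tidx l) : int := ((val t : nat)%:Z - l%:Z).

Definition detector (Y : finType) (l : nat) :=
  {ffun ({ffun 'I_l -> Y} * {ffun 'I_l -> Y}) -> Tidx l}.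

Definition Perror (R : realType) (X Y : finType) (pX : X -> R) (W : X -> Y -> R)
  (n l : nat) (f : detector Y l) : R :=
  \sum_(a : 'I_n) \sum_(j : 'I_(n + 3 * l).+1)
    pI R n l ((a : nat)%:Z + 1) ((j : nat)%:Z - l%:Z) *
    \sum_(x : window X n l) pXn pX x *
      \sum_(y1 : {ffun 'I_l -> Y}) \sum_(y2 : {ffun 'I_l -> Y})
        Wn W y1 (read x ((a : nat)%:Z + 1)) *
        Wn W y2 (read x ((j : nat)%:Z - l%:Z)) *
        (tval (f (y1, y2)) != overlap l ((a : nat)%:Z + 1) ((j : nat)%:Z - l%:Z))%:R.

(* optimal error probability (every P_error is <= 1) *)
Definition Pstar (R : realType) (X Y : finType) (pX : X -> R) (W : X -> Y -> R)
  (n l : nat) : R :=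
  \big[Num.min/1]_(f : detector Y l) Perror pX W n f.

(* Main.v *)
(** Let [r] be the likelihood ratio of [PYY] against the product of its
    marginals.  The detector fixes [m0] close to [ln n / J], where [J] is the
    mutual information in nats, and declares an overlap [t] with [|t| > m0]
    when the product of [r] over the letters matched by the corresponding shift
    is at least [n ^ (1 + delta)]; otherwise it declares no overlap.

    At every wrong shift the expected product is essentially at most [1], so by
    Markov's inequality and a union bound false alarms have probability
    [O(ln n / n ^ (1 + delta)) = o(ln n / n)].  At the true shift the matched
    letters are independent with law [PYY], and a Chernoff bound (expectation of
    the product of [r ^ (- lam)] for a small [lam]) makes a missed detection of
    an overlap longer than [m0] have probability [o(1)], which is weighted by
    [P(T <> 0) = O(ln n / n)].  What remains is
    [P(0 < |T| <= m0) <= 2 m0 / n].  The bound by [beta] comes from the detector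
    that never declares an overlap. *)

Require Import Defs.
From HB Require Import structures.
From mathcomp Require Import all_boot all_order all_algebra.
From mathcomp Require Import all_classical all_reals all_analysis.
From mathcomp Require Import zify ring lra.
Import Order.TTheory GRing.Theory Num.Theory.
Local Open Scope ring_scope.
Local Open Scope classical_set_scope.
Set Implicit Arguments.
Unset Strict Implicit.

(** * Expectations of products under an i.i.d. law *)

Section IidExpectation.
Variables (R : realType) (X I : finType) (pX : X -> R).
Hypothesis pX_pmf : is_pmf pX.

Definition iid_weight (x : {ffun I -> X}) : R := \prod_i pX (x i).

Definition update (x : {ffun I -> X}) (p : I) (z : X) : {ffun I -> X} :=
  [ffun i => if i == p then z else x i].

Lemma iid_weight_ge0 x : 0 <= iid_weight x.
Proof. by apply: prodr_ge0 => i _; case: pX_pmf. Qed.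

Lemma sum_iid_weight : \sum_x iid_weight x = 1.
Proof.
rewrite -(bigA_distr_bigA (fun (_ : I) z => pX z)) big1 // => i _.
by case: pX_pmf.
Qed.

Lemma iid_weight_update x p z :
  iid_weight (update x p z) * pX (x p) = iid_weight x * pX z.
Proof.
rewrite /iid_weight (bigD1 p) //= [in RHS](bigD1 p) //= ffunE eqxx.
rewrite (eq_bigr (fun i => pX (x i))); first by ring.
by move=> i /negbTE ip; rewrite ffunE ip.
Qed.

(** Exchanging coordinate [p] of [x] with an independent copy [z] is an involution that preserves
    the joint weight of [(x, z)]. *)
Lemma resample (p : I) (F : {ffun I -> X} -> R) :
  \sum_x iid_weight x * F x =
  \sum_x iid_weight x * \sum_z pX z * F (update x p z).
Proof.
under [RHS]eq_bigr do rewrite mulr_sumr.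
rewrite pair_big /=.
pose swap (u : {ffun I -> X} * X) := (update u.1 p u.2, u.1 p).
have swapK : involutive swap.
  move=> [x z]; rewrite /swap /= ffunE eqxx; congr (_, _).
  by apply/ffunP => i; rewrite !ffunE; case: eqP => // ->.
rewrite (reindex_inj (inv_inj swapK)) /=.
rewrite -(pair_big xpredT xpredT (fun x z => iid_weight (update x p z) *
  (pX (x p) * F (update (update x p z) p (x p))))) /=.
apply: eq_bigr => x _.
under eq_bigr => z _.
  have -> : update (update x p z) p (x p) = x.
    by apply/ffunP => i; rewrite !ffunE; case: eqP => // ->.
  rewrite mulrA iid_weight_update -mulrA mulrCA.
  over.
by rewrite -big_distrl /=; case: pX_pmf => _ ->; rewrite mul1r.
Qed.

(* The [k]-th factor is integrated over the coordinate [p k], on which no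
   earlier factor depends; going down from the last factor, the product of
   dependent factors is bounded as if they were independent. *)
Lemma iid_expect_prod_le (m : nat) (g : nat -> {ffun I -> X} -> R)
    (p : nat -> I) (C : nat -> R) :
  (forall k x, (k < m)%N -> 0 <= g k x) ->
  (forall k, (k < m)%N -> 0 <= C k) ->
  (forall k x, (k < m)%N -> \sum_z pX z * g k (update x (p k) z) <= C k) ->
  (forall j k x z, (j < k)%N -> (k < m)%N -> g j (update x (p k) z) = g j x) ->
  \sum_x iid_weight x * \prod_(k < m) g k x <= \prod_(k < m) C k.
Proof.
elim: m => [|m IH] g0 C0 gC gj.
  by under eq_bigr do rewrite big_ord0 mulr1; rewrite sum_iid_weight big_ord0.
rewrite (resample (p m)) [leRHS]big_ord_recr /=.
apply: le_trans (_ : \sum_x iid_weight x * \prod_(k < m) g k x * C m <= _).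
  apply: ler_sum => x _; rewrite -mulrA ler_wpM2l ?iid_weight_ge0 //.
  under eq_bigr => z _.
    rewrite big_ord_recr /=.
    under eq_bigr => k _ do rewrite gj //.
    rewrite mulrCA.
    over.
  rewrite -mulr_sumr ler_wpM2l ?gC //.
  by apply: prodr_ge0 => k _; apply: g0; rewrite ltnS ltnW.
rewrite -mulr_suml ler_wpM2r ?C0 //; apply: IH => *.
- by apply: g0; rewrite ltnS ltnW.
- by apply: C0; rewrite ltnS ltnW.
- by apply: gC; rewrite ltnS ltnW.
- by apply: gj => //; rewrite ltnS ltnW.
Qed.

End IidExpectation.

(** * Scores of two reads with fixed inputs *)

Section Score.
Variables (R : realType) (X Y : finType) (W : X -> Y -> R) (l : nat).
Hypothesis W_channel : is_channel W.

(** Letters [a] and [b] of the two reads sit at the same position exactly when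
    [a = b + (I(2) - I(1))], so [s] is a candidate displacement. Each letter enters at most one
    factor. *)
Definition score (r : Y -> Y -> R) (s : int) (y1 y2 : {ffun 'I_l -> Y}) : R :=
  \prod_(a < l) \prod_(b < l | (a : nat)%:Z == (b : nat)%:Z + s) r (y1 a) (y2 b).

Definition reads_expect (u1 u2 : {ffun 'I_l -> X})
    (F : {ffun 'I_l -> Y} -> {ffun 'I_l -> Y} -> R) : R :=
  \sum_(y1 : {ffun 'I_l -> Y}) \sum_(y2 : {ffun 'I_l -> Y})
    Wn W y1 u1 * Wn W y2 u2 * F y1 y2.

Definition input_score (r : Y -> Y -> R) (x x' : X) : R :=
  \sum_y \sum_y' W x y * (W x' y' * r y y').

Lemma Wn_ge0 (y : {ffun 'I_l -> Y}) u : 0 <= Wn W y u.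
Proof. by apply: prodr_ge0 => k _; case: (W_channel (u k)). Qed.

Lemma sum_Wn (u : {ffun 'I_l -> X}) : \sum_y Wn W y u = 1.
Proof.
rewrite -(bigA_distr_bigA (fun k y => W (u k) y)) big1 // => k _.
by case: (W_channel (u k)).
Qed.

Lemma reads_expect1 u1 u2 : reads_expect u1 u2 (fun _ _ => 1) = 1.
Proof.
rewrite /reads_expect; under eq_bigr => y1 _.
  under eq_bigr do rewrite mulr1.
  rewrite -mulr_sumr sum_Wn mulr1.
  over.
exact: sum_Wn.
Qed.

Lemma reads_expect_le u1 u2 F G :
  (forall y1 y2, F y1 y2 <= G y1 y2) ->
  reads_expect u1 u2 F <= reads_expect u1 u2 G.
Proof.
move=> FG; apply: ler_sum => y1 _; apply: ler_sum => y2 _.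
by rewrite ler_wpM2l // mulr_ge0 ?Wn_ge0.
Qed.

Lemma reads_expectD u1 u2 F G :
  reads_expect u1 u2 (fun y1 y2 => F y1 y2 + G y1 y2) =
  reads_expect u1 u2 F + reads_expect u1 u2 G.
Proof.
rewrite /reads_expect -big_split; apply: eq_bigr => y1 _ /=.
by rewrite -big_split; apply: eq_bigr => y2 _ /=; rewrite mulrDr.
Qed.

Lemma reads_expectZ u1 u2 c F :
  reads_expect u1 u2 (fun y1 y2 => c * F y1 y2) = c * reads_expect u1 u2 F.
Proof.
rewrite /reads_expect mulr_sumr; apply: eq_bigr => y1 _ /=.
by rewrite mulr_sumr; apply: eq_bigr => y2 _ /=; rewrite mulrCA.
Qed.

(** With at most one factor the expectation passes through the product; an empty product leaves the
    total mass [1]. *)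
Lemma pmf_sum_prod_subsingleton (J : finType) (w : Y -> R) (P : pred J)
    (F : J -> Y -> R) :
  \sum_y w y = 1 -> (forall i j, P i -> P j -> i = j) ->
  \sum_y w y * \prod_(j | P j) F j y = \prod_(j | P j) \sum_y w y * F j y.
Proof.
move=> w1 P1; case: (pickP P) => [j Pj|P0].
  have Pe : P =1 pred1 j.
    by move=> i; apply/idP/eqP => [Pi|->//]; exact: P1.
  rewrite (eq_bigl _ _ Pe) big_pred1_eq; apply: eq_bigr => y _.
  by rewrite (eq_bigl _ _ Pe) big_pred1_eq.
rewrite [RHS]big_pred0 //; apply: etrans w1; apply: eq_bigr => y _.
by rewrite big_pred0 // mulr1.
Qed.

(** Given the inputs the output letters are independent, and no letter lies in two matched pairs, so
    the expectation factors over the pairs. The first read is integrated out before the second. *)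
Lemma reads_expect_score r s u1 u2 :
  reads_expect u1 u2 (score r s) =
  \prod_(b < l) \prod_(a < l | (a : nat)%:Z == (b : nat)%:Z + s)
    input_score r (u1 a) (u2 b).
Proof.
have W1 x : \sum_y W x y = 1 by case: (W_channel x).
rewrite /reads_expect exchange_big /=.
under eq_bigr => y2 _.
  under eq_bigr => y1 _.
    rewrite [_ * Wn W y2 u2]mulrC -mulrA -big_split /=.
    over.
  rewrite -mulr_sumr.
  rewrite -(bigA_distr_bigA (fun (a : 'I_l) y => W (u1 a) y *
    \prod_(b < l | (a : nat)%:Z == (b : nat)%:Z + s) r y (y2 b))) /=.
  under eq_bigr => a _.
    rewrite pmf_sum_prod_subsingleton //; last first.
      by move=> i j /eqP ei /eqP ej; apply/val_inj => /=; lia.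
    over.
  rewrite (exchange_big_dep xpredT) //= -big_split /=.
  over.
rewrite -(bigA_distr_bigA (fun (b : 'I_l) y' => W (u2 b) y' *
  \prod_(a < l | (a : nat)%:Z == (b : nat)%:Z + s) \sum_y W (u1 a) y * r y y')).
apply: eq_bigr => b _.
rewrite pmf_sum_prod_subsingleton //; last first.
  by move=> i j /eqP ei /eqP ej; apply/val_inj => /=; lia.
apply: eq_bigr => a _.
rewrite /input_score exchange_big; apply: eq_bigr => y' _ /=.
by rewrite mulr_sumr; apply: eq_bigr => y _; rewrite mulrCA.
Qed.

End Score.

Lemma prod_shift_const (R : comPzRingType) (l k : nat) (C : R) :
  \prod_(b < l) \prod_(a < l | a == (b + k)%N :> nat) C = C ^+ (l - k).
Proof.
rewrite (eq_bigr (fun b : 'I_l => if (b < l - k)%N then C else 1)); last first.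
  move=> b _; case: ifPn => bk.
    have ak : (b + k < l)%N by lia.
    by rewrite (big_pred1 (Ordinal ak)) // => a; apply/eqP/eqP => [?|->] //;
      apply: val_inj.
  by rewrite big_pred0 // => a; apply/eqP; have := ltn_ord a; lia.
rewrite -big_mkcond -(big_ord_widen_cond l xpredT (fun=> C)) ?leq_subr //.
by rewrite prodr_const card_ord.
Qed.

Lemma prod_signed_shift_const (R : comPzRingType) (l : nat) (s : int) (C : R) :
  \prod_(b < l) \prod_(a < l | (a : nat)%:Z == (b : nat)%:Z + s) C =
  C ^+ (l - `|s|)%N.
Proof.
case: s => k.
  rewrite -[RHS]prod_shift_const; apply: eq_bigr => b _; apply: eq_bigl => a.
  by apply/eqP/eqP; lia.
(* A negative displacement becomes a positive one once the two indices are exchanged. *)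
rewrite -[RHS]prod_shift_const (exchange_big_dep xpredT) //=; apply: eq_bigr => b _.
by apply: eq_bigl => a; apply/eqP/eqP; lia.
Qed.

(** * Expected scores over the i.i.d. window *)

Section WindowScore.
Variables (R : realType) (X Y : finType) (pX : X -> R) (W : X -> Y -> R).
Variables (l N : nat).
Hypotheses (pX_pmf : is_pmf pX) (W_channel : is_channel W).

Definition segment (c : nat) (x : {ffun 'I_N.+1 -> X}) : {ffun 'I_l -> X} :=
  [ffun k : 'I_l => x (inord (c + k))].

Definition window_expect (c e : nat)
    (F : {ffun 'I_l -> Y} -> {ffun 'I_l -> Y} -> R) : R :=
  \sum_x iid_weight pX x * reads_expect W (segment c x) (segment e x) F.

Lemma window_expect1 c e : window_expect c e (fun _ _ => 1) = 1.
Proof.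
rewrite /window_expect; under eq_bigr do rewrite reads_expect1 // mulr1.
exact: sum_iid_weight.
Qed.

Lemma window_expect_le c e F G :
  (forall y1 y2, F y1 y2 <= G y1 y2) ->
  window_expect c e F <= window_expect c e G.
Proof.
move=> FG; apply: ler_sum => x _.
by rewrite ler_wpM2l ?iid_weight_ge0 // reads_expect_le.
Qed.

Lemma window_expectD c e F G :
  window_expect c e (fun y1 y2 => F y1 y2 + G y1 y2) =
  window_expect c e F + window_expect c e G.
Proof.
rewrite /window_expect -big_split; apply: eq_bigr => x _ /=.
by rewrite reads_expectD mulrDr.
Qed.

Lemma window_expectZ c e k F :
  window_expect c e (fun y1 y2 => k * F y1 y2) = k * window_expect c e F.
Proof.
rewrite /window_expect mulr_sumr; apply: eq_bigr => x _ /=.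
by rewrite reads_expectZ mulrCA.
Qed.

Lemma window_expect_sum c e (J : finType) (P : pred J) (F : J -> _) :
  window_expect c e (fun y1 y2 => \sum_(j | P j) F j y1 y2) =
  \sum_(j | P j) window_expect c e (F j).
Proof.
rewrite /window_expect exchange_big /=; apply: eq_bigr => x _.
rewrite -mulr_sumr; congr (_ * _).
rewrite /reads_expect [RHS]exchange_big /=; apply: eq_bigr => y1 _.
rewrite [RHS]exchange_big /=; apply: eq_bigr => y2 _.
by rewrite mulr_sumr.
Qed.

Lemma update_inord_neq (x : {ffun 'I_N.+1 -> X}) (u v : nat) z :
  (u <= N)%N -> (v <= N)%N -> u <> v ->
  update x (inord u) z (inord v) = x (inord v).
Proof.
move=> uN vN uv; rewrite ffunE; case: eqP => // /(congr1 val) /=.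
by rewrite !inordK ?ltnS // => /esym.
Qed.

Lemma update_eq (I : finType) (x : {ffun I -> X}) p z : update x p z p = z.
Proof. by rewrite ffunE eqxx. Qed.

Section PositiveScore.
Variable r : Y -> Y -> R.
Hypothesis r_ge0 : forall y y', 0 <= r y y'.

Lemma input_score_ge0 x x' : 0 <= input_score W r x x'.
Proof.
apply: sumr_ge0 => y _; apply: sumr_ge0 => y' _.
by rewrite !mulr_ge0 //; [case: (W_channel x) | case: (W_channel x')].
Qed.

Lemma window_expect_score c e s :
  window_expect c e (score r s) =
  \sum_(x : {ffun 'I_N.+1 -> X}) iid_weight pX x *
    \prod_(b < l) \prod_(a < l | (a : nat)%:Z == (b : nat)%:Z + s)
      input_score W r (x (inord (c + a))) (x (inord (e + b))).
Proof.
apply: eq_bigr => x _; rewrite reads_expect_score //; congr (_ * _).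
by apply: eq_bigr => b _; apply: eq_bigr => a _; rewrite !ffunE.
Qed.

Let matched_factor c e s (b : nat) (x : {ffun 'I_N.+1 -> X}) :=
  \prod_(a < l | (a : nat)%:Z == b%:Z + s)
      input_score W r (x (inord (c + a))) (x (inord (e + b))).

Lemma sum_matched_factor_le (C : R) c e s b x p : 0 <= C ->
  (forall a : 'I_l, (a : nat)%:Z = b%:Z + s -> \sum_z pX z *
    input_score W r (update x p z (inord (c + a)))
      (update x p z (inord (e + b))) <= C) ->
  \sum_z pX z * matched_factor c e s b (update x p z) <=
  \prod_(a < l | (a : nat)%:Z == b%:Z + s) C.
Proof.
move=> C0 H; rewrite pmf_sum_prod_subsingleton; first last.
- by move=> i j /eqP ei /eqP ej; apply/val_inj => /=; lia.
- by case: pX_pmf.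
apply: ler_prod => a /eqP ab; rewrite H // andbT.
by apply: sumr_ge0 => z _; rewrite mulr_ge0 ?input_score_ge0 //; case: pX_pmf.
Qed.

(* At a wrong shift the matched pairs of positions [(c + s + b, e + b)] form
   disjoint paths: the larger entry of the [b]-th pair is not used by the
   earlier pairs. *)
Lemma window_expect_score_wrong (C : R) c e s :
  (c + l.*2 <= N.+1)%N -> (e + l <= N.+1)%N -> s <= l%:Z ->
  s <> e%:Z - c%:Z -> 1 <= C ->
  (forall x', \sum_x pX x * input_score W r x x' <= C) ->
  (forall x, \sum_x' pX x' * input_score W r x x' <= C) ->
  window_expect c e (score r s) <= C ^+ l.
Proof.
move=> cN eN sl sce C1 C_left C_right; rewrite window_expect_score.
have C0 : 0 <= C by apply: le_trans C1.
(* An index [k] without a partner gives the empty product [1], which is where [1 <= C] enters. *)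
have gC k : \prod_(a < l | (a : nat)%:Z == k%:Z + s) C <= C.
  case: (pickP (fun a : 'I_l => (a : nat)%:Z == k%:Z + s)) => [a|] Pa.
    rewrite (big_pred1 a) // => a'; apply/eqP/eqP => [a's|->]; last exact/eqP.
    by apply/val_inj => /=; move/eqP: Pa; lia.
  by rewrite big_pred0.
have -> : C ^+ l = \prod_(k < l) C by rewrite prodr_const card_ord.
(* The larger of the two positions [c + s + k] and [e + k]. For an unmatched [k] the first can
   exceed the read, up to [c + 2 l - 1]; the bound on [c + l.*2] keeps it in the window, where
   [inord] is faithful. *)
pose p k : 'I_N.+1 :=
  inord (if e%:Z < c%:Z + s then absz (c%:Z + s + k%:Z) else (e + k)%N).
apply: (iid_expect_prod_le pX_pmf (g := matched_factor c e s) (p := p)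
  (C := fun=> C)) => //.
- by move=> k x kl; apply: prodr_ge0 => a _; apply: input_score_ge0.
- move=> k x kl; apply: le_trans (gC k); apply: sum_matched_factor_le => // a aks.
  rewrite /p; case: ifPn => ces.
    have -> : absz (c%:Z + s + k%:Z) = (c + a)%N by lia.
    have := C_left (x (inord (e + k))); apply: le_trans; apply: ler_sum => z _.
    by rewrite update_eq update_inord_neq //; have := ltn_ord a; lia.
  have := C_right (x (inord (c + a))); apply: le_trans; apply: ler_sum => z _.
  by rewrite update_eq update_inord_neq //; have := ltn_ord a; lia.
- move=> j k x z jk kl; apply: eq_bigr => a /eqP ajs.
  rewrite /p; case: ifPn => ces;
    by rewrite !update_inord_neq //; have := ltn_ord a; lia.
Qed.

(** At the true shift both letters of the [k]-th pair come from position [e + k], and these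
    positions are distinct. Since [C] may be below [1], the number of matched pairs is kept exactly
    in the exponent. *)
Lemma window_expect_score_true (C : R) c e s :
  (c + l <= N.+1)%N -> (e + l <= N.+1)%N -> s = e%:Z - c%:Z -> 0 <= C ->
  \sum_x pX x * input_score W r x x <= C ->
  window_expect c e (score r s) <= C ^+ (l - `|s|)%N.
Proof.
move=> cN eN sce C0 rC; rewrite window_expect_score -prod_signed_shift_const.
apply: (iid_expect_prod_le pX_pmf (g := matched_factor c e s)
  (p := fun k => inord (e + k))
  (C := fun k => \prod_(a < l | (a : nat)%:Z == k%:Z + s) C)) => //.
- by move=> k x kl; apply: prodr_ge0 => a _; apply: input_score_ge0.
- by move=> k kl; apply: prodr_ge0.
- move=> k x kl; apply: sum_matched_factor_le => // a aks.
  have -> : (c + a)%N = (e + k)%N by lia.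
  by under eq_bigr do rewrite update_eq.
- move=> j k x z jk kl; apply: eq_bigr => a /eqP ajs.
  by rewrite !update_inord_neq //; have := ltn_ord a; lia.
Qed.

End PositiveScore.

End WindowScore.

(** * Likelihood ratio and information density *)

Section InformationDensity.
Variables (R : realType) (X Y : finType) (pX : X -> R) (W : X -> Y -> R).
Hypotheses (pX_pmf : is_pmf pX) (W_channel : is_channel W).

Local Notation PY := (PY pX W).
Local Notation PYY := (PYY pX W).

Lemma PYY_ge0 y y' : 0 <= PYY y y'.
Proof.
apply: sumr_ge0 => x _; rewrite !mulr_ge0 //; first by case: pX_pmf.
- by case: (W_channel x).
- by case: (W_channel x).
Qed.

Lemma PY_ge0 y : 0 <= PY y.
Proof.
apply: sumr_ge0 => x _; rewrite !mulr_ge0 //; first by case: pX_pmf.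
by case: (W_channel x).
Qed.

Lemma PYYC y y' : PYY y y' = PYY y' y.
Proof. by apply: eq_bigr => x _; rewrite mulrAC. Qed.

Lemma sum_PYY_r y : \sum_y' PYY y y' = PY y.
Proof.
rewrite exchange_big; apply: eq_bigr => x _ /=.
by rewrite -mulr_sumr; case: (W_channel x) => _ ->; rewrite mulr1.
Qed.

Lemma sum_PYY_l y' : \sum_y PYY y y' = PY y'.
Proof. by under eq_bigr do rewrite PYYC; exact: sum_PYY_r. Qed.

Lemma sum_PY : \sum_y PY y = 1.
Proof.
rewrite exchange_big /= -[RHS](proj2 pX_pmf); apply: eq_bigr => x _.
by rewrite -mulr_sumr; case: (W_channel x) => _ ->; rewrite mulr1.
Qed.

Lemma sum_PYY : \sum_y \sum_y' PYY y y' = 1.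
Proof. by under eq_bigr do rewrite sum_PYY_r; exact: sum_PY. Qed.

Lemma PYY_le_PY y y' : PYY y y' <= PY y.
Proof.
rewrite -sum_PYY_r (bigD1 y') //= lerDl.
by apply: sumr_ge0 => *; exact: PYY_ge0.
Qed.

Lemma PY_gt0 y y' : PYY y y' != 0 -> 0 < PY y.
Proof.
move=> P0; apply: lt_le_trans (PYY_le_PY y y').
by rewrite lt_neqAle eq_sym P0 PYY_ge0.
Qed.

(* Off the support of [PYY] the likelihood ratio is replaced by a positive
   constant [theta], so that its logarithm is meaningful everywhere. *)
Definition likelihood_ratio (theta : R) (y y' : Y) : R :=
  if PYY y y' == 0 then theta else PYY y y' / (PY y * PY y').

Lemma likelihood_ratioC theta y y' :
  likelihood_ratio theta y y' = likelihood_ratio theta y' y.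
Proof. by rewrite /likelihood_ratio PYYC [PY y * _]mulrC. Qed.

Lemma likelihood_ratio_gt0 (theta : R) y y' :
  0 < theta -> 0 < likelihood_ratio theta y y'.
Proof.
move=> t0; rewrite /likelihood_ratio; case: eqP => // /eqP P0.
have y0 := PY_gt0 P0; have y'0 : 0 < PY y' by rewrite PYYC in P0; apply: PY_gt0 P0.
by rewrite divr_gt0 ?mulr_gt0 // lt_neqAle eq_sym P0 PYY_ge0.
Qed.

(** The support of [PYY] contributes at most the mass of a conditional law given [y'], and its
    complement at most [theta]. *)
Lemma sum_PY_likelihood_ratio_le (theta : R) y' : 0 <= theta ->
  \sum_y PY y * likelihood_ratio theta y y' <= 1 + theta.
Proof.
move=> t0.
apply: le_trans (_ : \sum_y (PYY y y' / PY y' + theta * PY y) <= _).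
  apply: ler_sum => y _; rewrite /likelihood_ratio; case: eqP => [->|/eqP P0].
    by rewrite mul0r add0r mulrC.
  have y0 := PY_gt0 P0.
  have y'0 : 0 < PY y' by rewrite PYYC in P0; apply: PY_gt0 P0.
  have -> : PY y * (PYY y y' / (PY y * PY y')) = PYY y y' / PY y'.
    by field; rewrite !gt_eqF.
  by rewrite lerDl mulr_ge0 // PY_ge0.
rewrite big_split /= -mulr_suml sum_PYY_l -mulr_sumr sum_PY mulr1 lerD2r.
(* The quotient is [0] when [PY y'] vanishes, since the inverse of [0] is [0]. *)
by have [->|/mulfV ->] := eqVneq (PY y') 0; rewrite ?mul0r.
Qed.

(** Averaged over [pX], the first output has law [PY] independently of the second: the situation at
    a wrong shift. *)
Lemma sum_input_score_l (r : Y -> Y -> R) x' :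
  \sum_x pX x * input_score W r x x' =
  \sum_y' W x' y' * \sum_y PY y * r y y'.
Proof.
under eq_bigr => x _.
  rewrite /input_score exchange_big mulr_sumr; over.
rewrite exchange_big /=; apply: eq_bigr => y' _.
under eq_bigr do rewrite mulr_sumr.
rewrite exchange_big mulr_sumr /=; apply: eq_bigr => y _.
by rewrite mulr_suml mulr_sumr; apply: eq_bigr => x _; ring.
Qed.

(** With a common input the two outputs have law [PYY]: the situation at the true shift. *)
Lemma sum_input_score_diag (r : Y -> Y -> R) :
  \sum_x pX x * input_score W r x x = \sum_y \sum_y' PYY y y' * r y y'.
Proof.
under eq_bigr do rewrite mulr_sumr.
rewrite exchange_big /=; apply: eq_bigr => y _.
under eq_bigr do rewrite mulr_sumr.
rewrite exchange_big /=; apply: eq_bigr => y' _.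
by rewrite mulr_suml; apply: eq_bigr => x _; rewrite !mulrA.
Qed.

Lemma input_scoreC (r : Y -> Y -> R) x x' :
  (forall y y', r y y' = r y' y) ->
  input_score W r x x' = input_score W r x' x.
Proof.
move=> rC; rewrite /input_score exchange_big /=; apply: eq_bigr => y _.
by apply: eq_bigr => y' _; rewrite rC mulrCA.
Qed.

Lemma sum_input_likelihood_ratio_l (theta : R) x' : 0 <= theta ->
  \sum_x pX x * input_score W (likelihood_ratio theta) x x' <= 1 + theta.
Proof.
move=> t0; rewrite sum_input_score_l; case: (W_channel x') => W0 W1.
rewrite -[leRHS]mul1r -[X in X * _]W1 mulr_suml; apply: ler_sum => y' _.
by rewrite ler_wpM2l // sum_PY_likelihood_ratio_le.
Qed.

Lemma sum_input_likelihood_ratio_r (theta : R) x : 0 <= theta ->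
  \sum_x' pX x' * input_score W (likelihood_ratio theta) x x' <= 1 + theta.
Proof.
move=> t0; under eq_bigr => x' _.
  rewrite input_scoreC; last by move=> *; exact: likelihood_ratioC.
  over.
exact: sum_input_likelihood_ratio_l.
Qed.

(** The information density in nats. *)
Definition density (y y' : Y) : R := ln (PYY y y' / (PY y * PY y')).

Definition density_mean : R := \sum_y \sum_y' PYY y y' * density y y'.

Definition density_sqmean : R := \sum_y \sum_y' PYY y y' * density y y' ^+ 2.

(** A crude uniform bound on the density, which limits the size of the tilt [lam]. *)
Definition density_bound : R := \sum_y \sum_y' `|density y y'|.

Lemma density_sqmean_ge0 : 0 <= density_sqmean.
Proof.
by do 2 (apply: sumr_ge0 => ? _); rewrite mulr_ge0 ?PYY_ge0 // sqr_ge0.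
Qed.

Lemma density_bound_ge0 : 0 <= density_bound.
Proof. by do 2 (apply: sumr_ge0 => ? _). Qed.

Lemma density_le_bound y y' : `|density y y'| <= density_bound.
Proof.
rewrite /density_bound (bigD1 y) //= (bigD1 y') //= -addrA lerDl addr_ge0 //.
  by apply: sumr_ge0.
by do 2 (apply: sumr_ge0 => ? _).
Qed.

Lemma mutinfo_density_mean b : mutinfo b pX W = density_mean / ln b%:R.
Proof.
rewrite /mutinfo /density_mean mulr_suml; apply: eq_bigr => y _.
rewrite mulr_suml; apply: eq_bigr => y' _; case: eqP => [->|_].
  by rewrite !mul0r.
by rewrite /logb /density mulrA.
Qed.

(** Gibbs' inequality: [ln q >= 1 - 1 / q] is applied termwise, and [PYY] and the product of its
    marginals have the same total mass. *)
Lemma density_mean_ge0 : 0 <= density_mean.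
Proof.
have H y y' : PYY y y' - PY y * PY y' <= PYY y y' * density y y'.
  have [->|P0] := eqVneq (PYY y y') 0.
    by rewrite mul0r sub0r oppr_le0 mulr_ge0 ?PY_ge0.
  have y0 := PY_gt0 P0.
  have y'0 : 0 < PY y' by rewrite PYYC in P0; apply: PY_gt0 P0.
  have P_gt0 : 0 < PYY y y' by rewrite lt_neqAle eq_sym P0 PYY_ge0.
  set q := PYY y y' / (PY y * PY y').
  have q0 : 0 < q by rewrite divr_gt0 ?mulr_gt0.
  have -> : PYY y y' - PY y * PY y' = PYY y y' * (1 - q^-1).
    by rewrite /q; field; rewrite !gt_eqF.
  rewrite ler_pM2l // /density -/q.
  have := le_ln1Dx (x := q^-1 - 1); rewrite addrCA subrr addr0.
  rewrite lnV ?posrE // => h.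
  suff : - ln q <= q^-1 - 1 by lra.
  by apply: h; rewrite ltrBrDl subrr invr_gt0.
apply: le_trans (_ : \sum_y \sum_y' (PYY y y' - PY y * PY y') <= _).
  under eq_bigr do
    rewrite big_split /= sum_PYY_r sumrN -mulr_sumr sum_PY mulr1 subrr.
  by rewrite big1.
by apply: ler_sum => y _; apply: ler_sum.
Qed.

(** From [1 - t <= expR (- t)] one gets [expR t <= 1 / (1 - t)], and [(1 - t) (1 + t + 2 t^2) = 1 +
    t^2 (1 - 2 t)]. *)
Lemma expR_le_quadratic (t : R) : t <= 1 / 2 -> expR t <= 1 + t + 2 * t ^+ 2.
Proof.
move=> t2.
have t1 : 0 < 1 - t by lra.
have h : 1 - t <= expR (- t) by have := expR_ge1Dx (- t); lra.
have : expR t * (1 - t) <= 1.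
  by rewrite -[leRHS](expRxMexpNx_1 t) ler_wpM2l // expR_ge0.
rewrite -ler_pdivlMr // => /le_trans; apply.
rewrite ler_pdivrMr //.
have := mulr_ge0 (sqr_ge0 t) (_ : 0 <= 1 - 2 * t); nra.
Qed.

(** Chernoff estimate for one letter: the exponential is expanded to second order, averaged, and
    [1 + u <= expR u] is applied. *)
Lemma tilted_likelihood_ratio_le (theta lam : R) : 0 <= lam ->
  lam * density_bound <= 1 / 2 ->
  \sum_y \sum_y' PYY y y' * expR (- lam * ln (likelihood_ratio theta y y')) <=
  expR (- lam * (density_mean - 2 * lam * density_sqmean)).
Proof.
move=> lam0 lamM.
apply: le_trans (expR_ge1Dx _).
have -> : 1 + - lam * (density_mean - 2 * lam * density_sqmean) =
  \sum_y \sum_y' PYY y y' *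
    (1 - lam * density y y' + 2 * (- lam * density y y') ^+ 2).
  transitivity (\sum_y \sum_y' (PYY y y' - lam * (PYY y y' * density y y') +
     2 * lam ^+ 2 * (PYY y y' * density y y' ^+ 2))).
    under [RHS]eq_bigr do rewrite !big_split /= sumrN -!mulr_sumr.
    rewrite !big_split /= sumrN -!mulr_sumr sum_PYY.
    by rewrite -/density_mean -/density_sqmean; ring.
  by apply: eq_bigr => y _; apply: eq_bigr => y' _; ring.
apply: ler_sum => y _; apply: ler_sum => y' _.
have [->|P0] := eqVneq (PYY y y') 0; first by rewrite !mul0r.
rewrite ler_wpM2l ?PYY_ge0 // /likelihood_ratio (negbTE P0) -/(density y y').
have := @expR_le_quadratic (- lam * density y y'); rewrite mulNr; apply.
apply: le_trans lamM; rewrite -mulrN ler_wpM2l //.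
by apply: le_trans (density_le_bound y y'); rewrite -normrN ler_norm.
Qed.

End InformationDensity.

(** * Counting displacements and overlaps *)

Section Overlap.
Variables (R : realType) (n l : nat).

(* The displacement [I(2) - I(1)] of the reads encoded by a nonzero signed
   overlap. *)
Definition shift_of_overlap (t : int) : int :=
  if 0 <= t then l%:Z - t else - l%:Z - t.

Lemma shift_of_overlap_le t : `|t| <= l%:Z -> shift_of_overlap t <= l%:Z.
Proof. by rewrite /shift_of_overlap; case: ifP => ? ?; lia. Qed.

Lemma Tset_overlap i1 i2 : Tset l (overlap l i1 i2).
Proof. by rewrite /Tset /overlap; case: ifP => h; lia. Qed.

Lemma overlap_shift t i1 i2 : Tset l t -> t != 0 ->
  shift_of_overlap t = i2 - i1 -> overlap l i1 i2 = t.
Proof.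
move=> Tt t0; rewrite /shift_of_overlap => ts; rewrite /overlap; move: Tt t0 ts.
by rewrite /Tset; case: ifP => ?; case: ifP => ?; lia.
Qed.

Lemma shift_overlap i1 i2 : overlap l i1 i2 != 0 ->
  shift_of_overlap (overlap l i1 i2) = i2 - i1.
Proof.
rewrite /shift_of_overlap => t0; case: ifP; move: t0; rewrite /overlap;
  by case: ifP; lia.
Qed.

(** Turns the number of pairs matched at the true shift into the length of the overlap. *)
Lemma absz_shift_of_overlap t : Tset l t -> t != 0 ->
  (l - `|shift_of_overlap t|)%N = `|t|%N.
Proof. by rewrite /Tset /shift_of_overlap => *; case: ifP; lia. Qed.

Lemma ex_Tidx t : Tset l t -> exists i : Tidx l, Defs.tval i = t.
Proof.
move=> Tt; have k_lt : (absz (t + l%:Z)%R < (2 * l).+1)%N.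
  by move: Tt; rewrite /Tset; lia.
have kt : (absz (t + l%:Z))%:Z - l%:Z = t by move: Tt; rewrite /Tset; lia.
have Tk : Tset l ((Ordinal k_lt : nat)%:Z - l%:Z) by rewrite /= kt.
by exists (exist _ (Ordinal k_lt) Tk); rewrite /Defs.tval /= kt.
Qed.

Lemma Tset_tval (t : Tidx l) : Tset l (Defs.tval t).
Proof. exact: (valP t). Qed.

Lemma card_Tidx : (#|{: Tidx l}| <= (2 * l).+1)%N.
Proof. by rewrite card_sig; apply: leq_trans (max_card _) _; rewrite card_ord. Qed.

Lemma card_ord_le_seq (m : nat) (P : pred 'I_m) (F : 'I_m -> int) (s : seq int) :
  (forall i j, P i -> P j -> F i = F j -> i = j) ->
  (forall i, P i -> F i \in s) -> (#|P| <= size s)%N.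
Proof.
move=> Finj Fs; rewrite cardE -(size_map F); apply: uniq_leq_size.
  rewrite map_inj_in_uniq ?enum_uniq // => i j.
  by rewrite !mem_enum => Pi Pj; apply: Finj.
by move=> t /mapP[i]; rewrite mem_enum => Pi ->; apply: Fs.
Qed.

(** Each of the three cases is an interval of [n] integers, starting at [lo]. *)
Lemma card_I2_support m i1 :
  (#|[pred j : 'I_m | I2_support n l i1 ((j : nat)%:Z - l%:Z)]| <= n)%N.
Proof.
pose lo : int := if i1 <= l%:Z - 1 then i1 - l%:Z + 1
  else if i1 <= n%:Z - l%:Z + 1 then 1 else i1 + l%:Z - n%:Z.
rewrite -[leqRHS](size_iota 0) -(size_map (fun k : nat => lo + k%:Z)).
apply: (card_ord_le_seq (F := fun j : 'I_m => (j : nat)%:Z - l%:Z)).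
  by move=> i j _ _ ij; apply: val_inj => /=; lia.
move=> j /= Hj; apply/mapP; exists (absz ((j : nat)%:Z - l%:Z - lo)%R).
  by rewrite mem_iota; move: Hj; rewrite /I2_support /lo; do 2?case: ifP; lia.
by move: Hj; rewrite /I2_support /lo; do 2?case: ifP; lia.
Qed.

(** For a fixed first position, a nonzero overlap determines the second position, and it takes one
    of the values [1, ..., k] up to sign. *)
Lemma card_short_overlap (m k : nat) i1 :
  (#|[pred j : 'I_m | (0 < `|overlap l i1 ((j : nat)%:Z - l%:Z)| <= k)%N]| <=
   2 * k)%N.
Proof.
have -> : (2 * k)%N = size ([seq t.+1%:Z | t <- iota 0 k] ++
                            [seq - t.+1%:Z | t <- iota 0 k]).
  by rewrite size_cat !size_map size_iota addnn mul2n.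
apply: (card_ord_le_seq (F := fun j : 'I_m => overlap l i1 ((j : nat)%:Z - l%:Z))).
  move=> i j /= Hi Hj ij; apply: val_inj => /=; move: Hi Hj ij.
  by rewrite /overlap; case: ifP; case: ifP; lia.
move=> j /=; set t := overlap _ _ _ => /andP[t0 tk]; rewrite mem_cat.
have [t_ge0|t_lt0] := leP 0 t; apply/orP; [left|right]; apply/mapP;
  exists (`|t|.-1)%N; rewrite ?mem_iota; lia.
Qed.

Lemma pI_ge0 i1 i2 : 0 <= pI R n l i1 i2.
Proof. by rewrite /pI; case: ifP => // _; rewrite mulr_ge0 ?invr_ge0 ?ler0n. Qed.

Lemma pI_window (a j : nat) : pI R n l (a%:Z + 1) (j%:Z - l%:Z) != 0 ->
  (a < n)%N /\ (j + l <= (n + 3 * l).+1)%N.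
Proof.
rewrite /pI; case: ifP; last by rewrite eqxx.
by rewrite /I2_support; do 2?case: ifP; lia.
Qed.

(** Each admissible pair has mass at most [1 / n^2], and there are [n] first positions. *)
Lemma sum_pI_pred_le (m : nat) (Q : 'I_n -> pred 'I_m) (k : nat) :
  (forall a : 'I_n, (#|[pred j : 'I_m |
      I2_support n l ((a : nat)%:Z + 1) ((j : nat)%:Z - l%:Z) && Q a j]| <= k)%N) ->
  \sum_(a < n) \sum_(j < m)
     pI R n l ((a : nat)%:Z + 1) ((j : nat)%:Z - l%:Z) * (Q a j)%:R <=
  k%:R / n%:R.
Proof.
move=> Qk; have [n0|n_gt0] := posnP n.
  by rewrite big1 ?divr_ge0 ?ler0n // => a _; have := ltn_ord a; lia.
have -> : k%:R / n%:R = \sum_(a < n) k%:R * (n%:R^-1 * n%:R^-1) :> R.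
  by rewrite sumr_const card_ord -mulr_natr; field; rewrite pnatr_eq0 -lt0n.
apply: ler_sum => a _; set p := n%:R^-1 * n%:R^-1.
have p0 : 0 <= p by rewrite mulr_ge0 ?invr_ge0 ?ler0n.
apply: le_trans (_ : \sum_(j < m | I2_support n l ((a : nat)%:Z + 1)
  ((j : nat)%:Z - l%:Z) && Q a j) p <= _).
  rewrite [leRHS]big_mkcond; apply: ler_sum => j _ /=; rewrite /pI.
  case: (I2_support _ _ _ _) => /=; last by rewrite andbF mul0r.
  by case: (Q a j) => /=; rewrite ?mulr0 // mulr1; case: ifP.
rewrite sumr_const -[leLHS]mulr_natl ler_wpM2r // ler_nat.
exact: leq_trans (Qk a).
Qed.

Lemma sum_pI_le1 (m : nat) :
  \sum_(a < n) \sum_(j < m) pI R n l ((a : nat)%:Z + 1) ((j : nat)%:Z - l%:Z) <= 1.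
Proof.
have := @sum_pI_pred_le m (fun _ => xpredT) n; under eq_bigr => a _.
  under eq_bigr do rewrite mulr1; over.
move=> h; apply: le_trans (h _) _ => [a|].
  apply: leq_trans (card_I2_support m ((a : nat)%:Z + 1)).
  by apply: subset_leq_card; apply/fintype.subsetP => j; rewrite !inE => /andP[].
by have [->|n0] := eqVneq (n%:R : R) 0; rewrite ?mul0r ?mulfV.
Qed.

Lemma sum_pI_short_overlap_le (m k : nat) :
  \sum_(a < n) \sum_(j < m) pI R n l ((a : nat)%:Z + 1) ((j : nat)%:Z - l%:Z) *
    (0 < `|overlap l ((a : nat)%:Z + 1) ((j : nat)%:Z - l%:Z)| <= k)%N%:R <=
  (2 * k)%:R / n%:R.
Proof.
apply: (@sum_pI_pred_le m (fun a j =>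
  (0 < `|overlap l ((a : nat)%:Z + 1) ((j : nat)%:Z - l%:Z)| <= k)%N)) => a.
apply: leq_trans (card_short_overlap m k ((a : nat)%:Z + 1)).
by apply: subset_leq_card; apply/fintype.subsetP => j; rewrite !inE => /andP[].
Qed.

End Overlap.

(** * Error probability of the score detector *)

Section ScoreDetector.
Variables (R : realType) (X Y : finType) (pX : X -> R) (W : X -> Y -> R).
Hypotheses (pX_pmf : is_pmf pX) (W_channel : is_channel W).
Variables (n l : nat).

Local Notation N := (n + 3 * l)%N.
(** Window indices are positions plus [l]: the first read starts at position [a + 1], the second at
    [j - l]. *)
Local Notation E a j :=
  (@window_expect R X Y pX W l N (a + 1 + l)%N j).
Local Notation i1 a := ((a : nat)%:Z + 1).
Local Notation i2 j := ((j : nat)%:Z - l%:Z).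

Lemma Perror_window (f : detector Y l) :
  Perror pX W n f = \sum_(a < n) \sum_(j < N.+1)
    pI R n l (i1 a) (i2 j) * E a j (fun y1 y2 =>
      (Defs.tval (f (y1, y2)) != overlap l (i1 a) (i2 j))%:R).
Proof.
apply: eq_bigr => a _; apply: eq_bigr => j _; congr (_ * _).
apply: eq_bigr => x _; congr (_ * _); rewrite /reads_expect.
have -> : read x (i1 a) = segment l (a + 1 + l) x.
  by apply/ffunP => k; rewrite !ffunE; congr (x (inord _)); lia.
have -> // : read x (i2 j) = segment l j x.
by apply/ffunP => k; rewrite !ffunE; congr (x (inord _)); lia.
Qed.

Lemma window_expect_bool_le1 a j (F : _ -> _ -> bool) :
  E a j (fun y1 y2 => (F y1 y2)%:R) <= 1.
Proof.
rewrite -[leRHS](window_expect1 l N pX_pmf W_channel (a + 1 + l) j).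
by apply: window_expect_le => // y1 y2; rewrite lern1 leq_b1.
Qed.

Lemma Pstar_le_Perror (f : detector Y l) : Pstar pX W n l <= Perror pX W n f.
Proof. exact: bigmin_le_cond. Qed.

(** The detector that always answers [0] errs only on a nonzero overlap, and each first position
    allows at most [2 l] of these. *)
Lemma Pstar_le_overlap : Pstar pX W n l <= (2 * l)%:R / n%:R.
Proof.
have [t0 t0E] : exists t : Tidx l, Defs.tval t = 0.
  by apply: ex_Tidx; rewrite /Tset eqxx orbT.
apply: le_trans (Pstar_le_Perror [ffun=> t0]) _; rewrite Perror_window.
apply: le_trans (sum_pI_short_overlap_le R n l N.+1 l).
apply: ler_sum => a _; apply: ler_sum => j _; rewrite ler_wpM2l ?pI_ge0 //.
have [t_eq0|t_neq0] := eqVneq (overlap l (i1 a) (i2 j)) 0.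
  apply: (@le_trans _ _ (E a j (fun _ _ => 0 * 1))).
    by apply: window_expect_le => // y1 y2; rewrite ffunE t0E t_eq0 eqxx mul0r.
  by rewrite window_expectZ mul0r.
have -> : (0 < `|overlap l (i1 a) (i2 j)| <= l)%N.
  by move: t_neq0 (Tset_overlap l (i1 a) (i2 j)); rewrite /Tset; lia.
exact: window_expect_bool_le1.
Qed.

Variables (theta lam C gamma : R) (m0 : nat).
Hypotheses (theta_gt0 : 0 < theta) (lam_ge0 : 0 <= lam) (gamma_gt0 : 0 < gamma).

Local Notation r := (likelihood_ratio pX W theta).

Definition tilted_ratio (y y' : Y) : R := expR (- lam * ln (r y y')).

Lemma r_gt0 y y' : 0 < r y y'.
Proof. exact: likelihood_ratio_gt0. Qed.

Lemma score_gt0 s (y1 y2 : {ffun 'I_l -> Y}) : 0 < score r s y1 y2.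
Proof. by apply: prodr_gt0 => a _; apply: prodr_gt0 => b _; apply: r_gt0. Qed.

Lemma score_tilted_ratio s (y1 y2 : {ffun 'I_l -> Y}) :
  score tilted_ratio s y1 y2 = expR (- lam * ln (score r s y1 y2)).
Proof.
pose K (u v : R) := 0 < v /\ u = expR (- lam * ln v).
suff [] : K (score tilted_ratio s y1 y2) (score r s y1 y2) by [].
have K1 : K 1 1 by split; rewrite ?ln1 ?mulr0 ?expR0.
have KM u1 v1 u2 v2 : K u1 v1 -> K u2 v2 -> K (u1 * u2) (v1 * v2).
  move=> [v1_gt0 ->] [v2_gt0 ->]; split; first exact: mulr_gt0.
  by rewrite lnM ?posrE // mulrDr expRD.
apply: (big_ind2 K) => // a _; apply: (big_ind2 K) => // b _.
by split => //; apply: r_gt0.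
Qed.

Definition passes (t : Tidx l) (y : {ffun 'I_l -> Y} * {ffun 'I_l -> Y}) : bool :=
  (m0 < `|Defs.tval t|)%N &&
  (gamma <= score r (shift_of_overlap l (Defs.tval t)) y.1 y.2).

(** Any passing [t] may be picked, so every wrong passing [t] is charged as a false alarm. *)
Definition score_detector (t0 : Tidx l) : detector Y l :=
  [ffun y => odflt t0 [pick t | passes t y]].

(** On an error one term is at least [1]: a wrong declared [t] has score at least [gamma]; otherwise
    nothing passes, and the true overlap is either short or has score below [gamma], which makes its
    tilted score large. *)
Lemma score_detector_error (t0 : Tidx l) (tau : int) y1 y2 :
  Defs.tval t0 = 0 -> Tset l tau ->
  (Defs.tval (score_detector t0 (y1, y2)) != tau)%:R <=
    \sum_(t : Tidx l | (m0 < `|Defs.tval t|)%N && (Defs.tval t != tau))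
      gamma^-1 * score r (shift_of_overlap l (Defs.tval t)) y1 y2 +
    ((0 < `|tau| <= m0)%N%:R +
     (m0 < `|tau|)%N%:R * expR (lam * ln gamma) *
       score tilted_ratio (shift_of_overlap l tau) y1 y2).
Proof.
move=> t0E Ttau.
have sum_ge0 :
    0 <= \sum_(t : Tidx l | (m0 < `|Defs.tval t|)%N && (Defs.tval t != tau))
      gamma^-1 * score r (shift_of_overlap l (Defs.tval t)) y1 y2.
  by apply: sumr_ge0 => t _; rewrite mulr_ge0 ?invr_ge0 ?ltW ?score_gt0.
have last_ge0 : 0 <= (m0 < `|tau|)%N%:R * expR (lam * ln gamma) *
       score tilted_ratio (shift_of_overlap l tau) y1 y2.
  by rewrite score_tilted_ratio !mulr_ge0 ?expR_ge0 ?ler0n.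
have mid_ge0 : 0 <= (0 < `|tau| <= m0)%N%:R :> R by [].
have [|ne_tau] := eqVneq (Defs.tval (score_detector t0 (y1, y2))) tau.
  by move=> _; rewrite !addr_ge0.
move: ne_tau; rewrite ffunE /=; case: pickP => [t /andP[/= mt gt]|no_pass] /=.
  move=> t_tau; apply: ler_wpDr; first exact: addr_ge0.
  rewrite (bigD1 t) /=; last by rewrite mt.
  apply: ler_wpDr.
    by apply: sumr_ge0 => t' _; rewrite mulr_ge0 ?invr_ge0 ?ltW ?score_gt0.
  by rewrite ler_pdivlMl // mulr1.
rewrite t0E eq_sym => tau0; apply: ler_wpDl => //.
have [tau_m0|m0tau] := leqP `|tau| m0.
  by rewrite andbT !mul0r addr0 absz_gt0 tau0.
rewrite andbF add0r mul1r score_tilted_ratio -expRD -[leLHS]expR0 ler_expR.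
have [t tE] := ex_Tidx Ttau.
have := no_pass t; rewrite /passes tE m0tau /= => /negbT; rewrite -ltNge => lt_g.
rewrite mulNr -mulrBr mulr_ge0 // subr_ge0 ler_ln ?posrE ?score_gt0 //.
exact: ltW.
Qed.

Hypothesis theta_l : (1 + theta) ^+ l <= expR 1.
Hypotheses (C_ge0 : 0 <= C) (C_le1 : C <= 1).
Hypothesis tilted_C : \sum_y \sum_y' PYY pX W y y' * tilted_ratio y y' <= C.

Lemma score_detector_window_error (t0 : Tidx l) (a j : nat) :
  Defs.tval t0 = 0 -> (a < n)%N -> (j + l <= N.+1)%N ->
  E a j (fun y1 y2 => (Defs.tval (score_detector t0 (y1, y2)) !=
                        overlap l (i1 a) (i2 j))%:R) <=
    (2 * l).+1%:R * (gamma^-1 * expR 1) +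
    ((0 < `|overlap l (i1 a) (i2 j)| <= m0)%N%:R +
     (0 < `|overlap l (i1 a) (i2 j)| <= l)%N%:R *
       (expR (lam * ln gamma) * C ^+ m0.+1)).
Proof.
move=> t0E an jN; set tau := overlap _ _ _.
have Ttau : Tset l tau by exact: Tset_overlap.
eapply le_trans.
  by apply: window_expect_le => // y1 y2; exact: score_detector_error.
rewrite window_expectD window_expect_sum; apply: lerD.
  apply: le_trans (_ : \sum_(t : Tidx l |
    (m0 < `|Defs.tval t|)%N && (Defs.tval t != tau)) gamma^-1 * expR 1 <= _).
    apply: ler_sum => t /andP[mt t_tau].
    rewrite window_expectZ; apply: ler_wpM2l; first by rewrite invr_ge0 ltW.
    apply: le_trans theta_l; apply: window_expect_score_wrong => //.
    - by move=> y y'; apply/ltW/r_gt0.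
    - by lia.
    - apply: shift_of_overlap_le; have := Tset_tval t; rewrite /Tset; lia.
    - move=> st; move/eqP: t_tau; apply; apply/esym; apply: overlap_shift.
      + exact: Tset_tval.
      + by apply/eqP => t_eq0; move: mt; rewrite t_eq0.
      + by rewrite st; lia.
    - by rewrite lerDl ltW.
    - by move=> x'; apply: sum_input_likelihood_ratio_l => //; apply: ltW.
    - by move=> x; apply: sum_input_likelihood_ratio_r => //; apply: ltW.
  rewrite sumr_const -[leLHS]mulr_natl ler_wpM2r //.
    by rewrite mulr_ge0 ?invr_ge0 ?expR_ge0 ?ltW.
  by rewrite ler_nat; apply: leq_trans (card_Tidx l); exact: max_card.
rewrite window_expectD; apply: lerD.
  apply: (@le_trans _ _ (E a j (fun _ _ => (0 < `|tau| <= m0)%N%:R * 1))).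
    by apply: window_expect_le => // y1 y2; rewrite mulr1.
  by rewrite window_expectZ (window_expect1 l N pX_pmf W_channel) mulr1.
rewrite window_expectZ -mulrA.
have [tau_m0|m0tau] := leqP `|tau| m0.
  by rewrite mul0r !mulr_ge0 ?expR_ge0 ?exprn_ge0.
have tau_l : (0 < `|tau| <= l)%N by move: Ttau; rewrite /Tset; lia.
rewrite tau_l !mul1r ler_wpM2l ?expR_ge0 //.
have tau_neq0 : tau != 0 by rewrite -absz_gt0; apply: leq_ltn_trans m0tau.
apply: le_trans (_ : C ^+ (l - `|shift_of_overlap l tau|)%N <= _).
  apply: window_expect_score_true => //.
  - by move=> y y'; apply: expR_ge0.
  - by lia.
  - by rewrite /tau shift_overlap //; lia.
  - by rewrite sum_input_score_diag.
(* More than [m0] letters are matched and [C <= 1], so the exponent can be lowered to [m0.+1]. *)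
by rewrite absz_shift_of_overlap // ler_wiXn2l.
Qed.

(** Averaging over the positions, the false alarms are weighted by a total mass at most [1], the
    misses only by the probability of a nonzero overlap. *)
Lemma Pstar_le_score : Pstar pX W n l <=
  (2 * l).+1%:R * (gamma^-1 * expR 1) +
  ((2 * m0)%:R / n%:R +
   (2 * l)%:R / n%:R * (expR (lam * ln gamma) * C ^+ m0.+1)).
Proof.
have [t0 t0E] : exists t : Tidx l, Defs.tval t = 0.
  by apply: ex_Tidx; rewrite /Tset eqxx orbT.
apply: le_trans (Pstar_le_Perror (score_detector t0)) _; rewrite Perror_window.
set A := (2 * l).+1%:R * _; set D := expR (lam * ln gamma) * _.
have A_ge0 : 0 <= A by rewrite !mulr_ge0 ?invr_ge0 ?expR_ge0 ?ltW ?ler0n.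
have D_ge0 : 0 <= D by rewrite mulr_ge0 ?expR_ge0 ?exprn_ge0.
apply: le_trans (_ : \sum_(a < n) \sum_(j < N.+1) (
  A * pI R n l (i1 a) (i2 j) +
  (pI R n l (i1 a) (i2 j) * (0 < `|overlap l (i1 a) (i2 j)| <= m0)%N%:R +
   D * (pI R n l (i1 a) (i2 j) *
     (0 < `|overlap l (i1 a) (i2 j)| <= l)%N%:R))) <= _).
  apply: ler_sum => a _; apply: ler_sum => j _.
  have [->|pI0] := eqVneq (pI R n l (i1 a) (i2 j)) 0.
    by rewrite !mul0r !mulr0 !addr0.
  have [an jN] := pI_window pI0.
  rewrite [A * _]mulrC [D * _]mulrC -!mulrA -!mulrDr ler_wpM2l ?pI_ge0 //.
  exact: score_detector_window_error.
under eq_bigr do rewrite !big_split /= -!mulr_sumr.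
rewrite !big_split /= -!mulr_sumr; apply: lerD.
  by rewrite -[leRHS]mulr1 ler_wpM2l // sum_pI_le1.
apply: lerD; first exact: sum_pI_short_overlap_le.
by rewrite [leRHS]mulrC ler_wpM2l // sum_pI_short_overlap_le.
Qed.

End ScoreDetector.

(** * Choice of the parameters and limit in [n] *)

Section Asymptotics.
Variables (R : realType) (X Y : finType) (pX : X -> R) (W : X -> Y -> R).
Variables (beta : R) (ell : nat -> nat).
Hypotheses (X_gt1 : (1 < #|X|)%N) (pX_pmf : is_pmf pX).
Hypotheses (W_channel : is_channel W) (beta_gt0 : 0 < beta).
Hypothesis ell_close : forall n : nat, (0 < n)%N ->
  `|(ell n)%:R - beta * logb #|X| (n%:R : R)| < 1.

Local Notation P n := (Pstar pX W n (ell n)).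
Local Notation J := (density_mean pX W).
Local Notation V := (density_sqmean pX W).
Local Notation M := (density_bound pX W).

Lemma ln_card_gt0 : 0 < ln (#|X|%:R : R).
Proof. by rewrite ln_gt0 // ltr1n. Qed.

Lemma ell_le n : (0 < n)%N ->
  (ell n)%:R <= beta / ln (#|X|%:R : R) * ln (n%:R : R) + 1.
Proof.
move=> n0; have := ell_close n0; rewrite ltr_norml /logb mulrA => /andP[_].
by rewrite mulrAC; lra.
Qed.

(** The rounding error of [ell n], at most [1], is absorbed by [eps * beta * log n] for large
    [n]. *)
Lemma Pstar_le_beta_eventually (eps : R) : 0 < eps -> exists L0 : R,
  forall n, (0 < n)%N -> L0 <= ln n%:R ->
  P n <= 2 * (1 + eps) * beta * (logb #|X| n%:R / n%:R).
Proof.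
move=> eps0; set lb := ln (#|X|%:R : R); have lb0 : 0 < lb := ln_card_gt0.
exists (lb / (eps * beta)) => n n0; rewrite ler_pdivrMr ?mulr_gt0 // => Ln.
apply: le_trans (Pstar_le_overlap pX_pmf W_channel n (ell n)) _.
rewrite mulrA ler_pM2r ?invr_gt0 ?ltr0n // natrM /logb -/lb.
have := ell_le n0; rewrite -/lb.
have : 1 <= eps * (beta / lb * ln n%:R).
  have -> : eps * (beta / lb * ln n%:R) = ln n%:R * (eps * beta) / lb by ring.
  by rewrite ler_pdivlMr // mul1r.
have -> : 2 * (1 + eps) * beta * (ln n%:R / lb) =
  2 * (beta / lb * ln n%:R) + 2 * (eps * (beta / lb * ln n%:R)) by ring.
lra.
Qed.

(** Half of the slack [eps] pays for the cut-off [m0] exceeding [L / J]; the remaining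
    [eps / J * L / n] covers false alarms and misses. *)
Lemma Pstar_le_mutinfo_eventually (eps : R) : 0 < eps -> 0 < J -> exists L0 : R,
  forall n, (0 < n)%N -> L0 <= ln n%:R ->
  P n <= 2 * (1 + eps) * (mutinfo #|X| pX W)^-1 * (logb #|X| n%:R / n%:R).
Proof.
move=> eps0 J0; set lb := ln (#|X|%:R : R); have lb0 : 0 < lb := ln_card_gt0.
pose B := beta / lb; have B0 : 0 < B by rewrite divr_gt0.
(* Chosen so that [1 + 2 delta] stays below [1 + eps / 2]; [kappa] is the fraction of [J] that the
   tilt may lose. *)
pose delta := eps / 8; have delta0 : 0 < delta by rewrite divr_gt0.
have [kappa kappa0 kappaE] : exists2 kappa : R, 0 < kappa &
    1 + 2 * delta = (1 + eps / 2) * (1 - kappa).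
  exists (eps / 4 / (1 + eps / 2)); last by rewrite /delta; field; lra.
  by rewrite !divr_gt0 // addr_gt0 // divr_gt0.
have M0 : 0 <= M := density_bound_ge0 pX W.
have V0 : 0 <= V := density_sqmean_ge0 pX_pmf W_channel.
have VK0 : 0 <= 2 * V / (kappa * J).
  by apply: divr_ge0; apply: mulr_ge0 => //; apply: ltW.
set VK := 2 * V / (kappa * J) in VK0.
(* The three summands of [q] give the three constraints on [lam = 1 / q]. *)
pose q := 1 + 2 * M + VK; have q1 : 1 <= q by rewrite /q; lra.
have q0 : 0 < q by apply: lt_le_trans q1.
have [lam [lam0 lam1 [lamM lamV]]] : exists lam : R, [/\ 0 < lam,
    lam <= 1 & lam * M <= 1 / 2 /\ 2 * lam * V <= kappa * J].
  exists q^-1; split; rewrite ?invr_gt0 ?invf_le1 //; split.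
    by rewrite mulrC ler_pdivrMr // /q; lra.
  have -> : 2 * q^-1 * V = VK * (kappa * J) / q.
    rewrite /VK divfK; last by rewrite gt_eqF // mulr_gt0.
    by rewrite mulrAC.
  by rewrite ler_pdivrMr // [leLHS]mulrC ler_pM2l ?mulr_gt0 // /q; lra.
pose K := J - 2 * lam * V.
have K_ge : (1 + 2 * delta) * J <= (1 + eps / 2) * K.
  rewrite kappaE -mulrA; apply: ler_wpM2l; last by rewrite /K; lra.
  by rewrite addr_ge0 // divr_ge0 // ltW.
have K0 : 0 < K.
  have : 0 < (1 + eps / 2) * K.
    by apply: lt_le_trans K_ge; apply: mulr_gt0 => //; lra.
  by rewrite pmulr_rgt0 //; lra.
(* [D * eta * L / n] will bound false alarms and misses together. *)
pose D := (2 * B + 3) * expR 1 + 2 * (B + 1).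
have D0 : 0 < D.
  by apply: addr_gt0; apply: mulr_gt0; rewrite ?expR_gt0 //; lra.
(* The bound [1 <= L] absorbs additive constants into [L]; the other makes [D * eta <= eps / J]. *)
exists (Num.max 1 (D * J / (lam * delta * eps))) => n n0; rewrite ge_max.
set L := ln (n%:R : R) => /andP[L1 LD].
have L0 : 0 < L by apply: lt_le_trans L1.
have nE : n%:R = expR L by rewrite lnK // posrE ltr0n.
(* Truncation gives both bounds: [m0] is at most the target, for the short overlaps, and [m0.+1]
   exceeds it, for the exponent of the misses. *)
pose m0 := Num.truncn ((1 + eps / 2) * L / J).
have x0 : 0 <= (1 + eps / 2) * L / J.
  by apply: divr_ge0; [apply: mulr_ge0; lra|apply: ltW].
have m0_le : m0%:R <= (1 + eps / 2) * L / J by rewrite truncn_le.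
have m0_gt : (1 + eps / 2) * L / J < m0.+1%:R by rewrite truncnS_gt.
pose theta : R := (ell n).+1%:R^-1.
have theta0 : 0 < theta by rewrite invr_gt0 ltr0n.
have theta_l : (1 + theta) ^+ ell n <= expR 1.
  apply: (@le_trans _ _ (expR theta ^+ ell n)).
    by rewrite lerXn2r ?nnegrE ?addr_ge0 ?expR_ge0 ?(ltW theta0) // expR_ge1Dx.
  rewrite -expRM_natl ler_expR /theta ler_pdivrMr ?ltr0n // mul1r.
  by rewrite ler_nat.
have := @Pstar_le_score R X Y pX W pX_pmf W_channel n (ell n) theta lam
  (expR (- lam * K)) (expR ((1 + delta) * L)) m0 theta0 (ltW lam0) (expR_gt0 _)
  theta_l (expR_ge0 _).
rewrite expR_le1 mulNr oppr_le0 mulr_ge0 ?(ltW lam0) ?(ltW K0) // => /(_ isT).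
rewrite -mulNr.
move=> /(_ (tilted_likelihood_ratio_le pX_pmf W_channel theta (ltW lam0) lamM)).
move=> /le_trans; apply.
(* This is [n ^ (- lam * delta)]. As [lam <= 1], it also dominates the factor [n ^ (- delta)] of the
   false alarms. *)
set eta := expR (- (lam * delta * L)).
have gamma_eta : (expR ((1 + delta) * L))^-1 <= eta / n%:R.
  rewrite -expRN nE -expRN -expRD ler_expR.
  have : lam * (delta * L) <= 1 * (delta * L).
    by rewrite ler_wpM2r // mulr_ge0 ?ltW.
  lra.
have C_eta : expR (lam * ln (expR ((1 + delta) * L))) *
    expR (- lam * K) ^+ m0.+1 <= eta.
  rewrite expRK -expRM_natl -expRD ler_expR.
  have : (1 + 2 * delta) * L <= m0.+1%:R * K.
    apply: (@le_trans _ _ ((1 + eps / 2) * L / J * K)).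
      rewrite mulrAC ler_pdivlMr // [leLHS]mulrAC [leRHS]mulrAC.
      by rewrite ler_pM2r.
    by rewrite ler_pM2r // ltW.
  move=> h; have := ler_wpM2l (ltW lam0) h; lra.
have eta_small : D * eta <= eps / J.
  have : eta <= (lam * delta * L)^-1.
    rewrite /eta expRN lef_pV2 ?posrE ?expR_gt0 ?mulr_gt0 //.
    by apply: le_trans (expR_ge1Dx _); rewrite lerDr.
  move=> /(ler_wpM2l (ltW D0)) /le_trans; apply.
  move: LD; rewrite ler_pdivrMr ?mulr_gt0 // => LD.
  rewrite ler_pdivrMr ?mulr_gt0 // mulrAC ler_pdivlMr //.
  apply: le_trans LD _.
  by rewrite le_eqVlt; apply/orP; left; apply/eqP; ring.
have l_le : (ell n)%:R <= (B + 1) * L.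
  by apply: le_trans (ell_le n0) _; rewrite -/lb -/B -/L mulrDl mul1r lerD2l.
have eta0 : 0 <= eta := expR_ge0 _.
have ninv0 : 0 < (n%:R : R)^-1 by rewrite invr_gt0 ltr0n.
have IE : (mutinfo #|X| pX W)^-1 * (logb #|X| n%:R / n%:R) = L / J / n%:R.
  rewrite mutinfo_density_mean /logb -/lb -/L; field.
  by rewrite !gt_eqF // ltr0n.
rewrite -[leRHS]mulrA IE.
apply: (@le_trans _ _ (((2 * ell n).+1%:R * (eta * expR 1) + ((2 * m0)%:R +
   (2 * ell n)%:R * eta)) / n%:R)).
  rewrite [leRHS]mulrDl; apply: lerD.
    rewrite -[leRHS]mulrA; apply: ler_wpM2l => //.
    by rewrite [leRHS]mulrAC; apply: ler_wpM2r => //; exact: expR_ge0.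
  rewrite [leRHS]mulrDl lerD2l [leRHS]mulrAC; exact: ler_wpM2l.
rewrite [leRHS]mulrA ler_pM2r //.
have h1 : (2 * ell n).+1%:R * (eta * expR 1) <= (2 * B + 3) * L * (eta * expR 1).
  apply: ler_wpM2r; first by rewrite mulr_ge0 ?expR_ge0.
  have -> : (2 * B + 3) * L = 2 * ((B + 1) * L) + L by ring.
  by rewrite -natr1 natrM; apply: lerD => //; rewrite ler_pM2l.
have h2 : (2 * ell n)%:R * eta <= 2 * (B + 1) * L * eta.
  by apply: ler_wpM2r => //; rewrite natrM -[leRHS]mulrA ler_pM2l.
have h3 : (2 * m0)%:R <= 2 * ((1 + eps / 2) * L / J) by rewrite natrM ler_pM2l.
have h4 : D * eta * L <= eps / J * L by rewrite ler_pM2r.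
have -> : 2 * (1 + eps) * (L / J) = 2 * ((1 + eps / 2) * L / J) + eps / J * L.
  by field; rewrite gt_eqF.
apply: le_trans (lerD h1 (lerD h3 h2)) _; rewrite addrCA lerD2l.
by apply: le_trans h4; rewrite le_eqVlt; apply/orP; left; apply/eqP;
  rewrite /D; ring.
Qed.

(** Allows division by the main term when the sequence [eps] is defined. *)
Lemma minfac_gt0 : 0 < minfac beta (mutinfo #|X| pX W).
Proof.
rewrite /minfac; case: eqP => // /eqP I0; rewrite lt_min beta_gt0 invr_gt0.
rewrite lt_neqAle eq_sym I0 mutinfo_density_mean.
by rewrite divr_ge0 ?(ltW ln_card_gt0) ?density_mean_ge0.
Qed.

Lemma Pstar_le_minfac_eventually (eps : R) : 0 < eps -> exists L0 : R,
  forall n, (0 < n)%N -> L0 <= ln n%:R ->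
  P n <= 2 * (1 + eps) * minfac beta (mutinfo #|X| pX W) *
    (logb #|X| n%:R / n%:R).
Proof.
move=> eps0; have [L1 H1] := Pstar_le_beta_eventually eps0.
rewrite /minfac; case: eqP => [_|/eqP I0]; first by exists L1.
have J0 : 0 < J.
  rewrite lt_neqAle eq_sym density_mean_ge0 // andbT.
  by apply: contra_neq I0 => J0; rewrite mutinfo_density_mean J0 mul0r.
have [L2 H2] := Pstar_le_mutinfo_eventually eps0 J0.
exists (Num.max L1 L2) => n n0; rewrite ge_max => /andP[L1n L2n].
by rewrite /Num.min; case: ifP => _; [apply: H1|apply: H2].
Qed.

Lemma ln_nat_ge_eventually (L0 : R) :
  exists n0 : nat, forall n, (n0 <= n)%N -> (0 < n)%N -> L0 <= ln n%:R.
Proof.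
exists (Num.truncn (expR L0)).+1 => n n0 n_gt0.
rewrite -[leLHS]expRK ler_ln ?posrE ?expR_gt0 ?ltr0n //.
apply: le_trans (ltW (truncnS_gt _)) _.
by rewrite ler_nat.
Qed.

End Asymptotics.

(** * Construction of the sequence [eps] *)

Unset Implicit Arguments.
Set Strict Implicit.

Theorem mainTheorem3 (R : realType) (X Y : finType) (pX : X -> R)
  (W : X -> Y -> R) (beta : R) :
  (1 < #|X|)%N -> is_pmf pX -> is_channel W -> 0 < beta ->
  forall ell : nat -> nat,
    (forall n : nat, (0 < n)%N ->
       `|(ell n)%:R - beta * logb #|X| (n%:R : R)| < 1) ->
  exists eps : nat -> R,
    eps @ \oo --> (0 : R^o) /\
    forall n : nat, (0 < n)%N ->
      Pstar pX W n (ell n) <=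
        2 * (1 + eps n) * minfac beta (mutinfo #|X| pX W)
          * (logb #|X| (n%:R : R) / n%:R).
Proof.
move=> X1 pX_pmf W_channel beta0 ell ell_close.
set mf := minfac beta (mutinfo #|X| pX W).
have mf0 : 0 < mf by apply: minfac_gt0.
have lb0 := ln_card_gt0 R X1.
pose D n : R := 2 * mf * (logb #|X| n%:R / n%:R).
have D0 n : (1 < n)%N -> 0 < D n.
  move=> n1; apply: mulr_gt0; first exact: mulr_gt0.
  rewrite divr_gt0 ?ltr0n ?(ltnW n1) // /logb divr_gt0 // ln_gt0 //.
  by rewrite ltr1n.
(* The least nonnegative value satisfying the inequality when [n > 1]; the eventual bounds for each
   fixed [e] force it to tend to [0]. *)
exists (fun n => Num.max 0 (Pstar pX W n (ell n) / D n - 1)); split.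
  apply/cvgrPdist_le => e e0.
  have [L0 H] := Pstar_le_minfac_eventually X1 pX_pmf W_channel beta0 ell_close e0.
  have [n0 Hn0] := ln_nat_ge_eventually L0.
  exists (maxn n0 2) => // n /=; rewrite geq_max => /andP[n0n n2].
  have n_gt0 : (0 < n)%N by apply: ltnW.
  rewrite sub0r normrN ger0_norm ?le_max ?lexx // ge_max ltW //=.
  rewrite lerBlDl ler_pdivrMr ?D0 //.
  have := H n n_gt0 (Hn0 n n0n n_gt0); rewrite /D -/mf.
  move=> /le_trans; apply; rewrite le_eqVlt; apply/orP; left; apply/eqP; ring.
(* At [n = 1] the main term is [0], but then [ell 1 = 0] and the error bound is [0] as well. *)
move=> n n_gt0; have [n1|] := ltnP 1 n; last first.
  move=> n_le1; have n1 : n = 1%N by apply/eqP; rewrite eqn_leq n_le1.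
  have ell0 : ell n = 0%N.
    have := ell_close n n_gt0; rewrite n1 /logb ln1 mul0r mulr0 subr0 ger0_norm //.
    by rewrite (ltr_nat _ _ 1) ltnS leqn0 => /eqP.
  apply: le_trans (Pstar_le_overlap pX_pmf W_channel n (ell n)) _.
  by rewrite ell0 muln0 mul0r n1 /logb ln1 !mul0r mulr0.
have -> : 2 * (1 + Num.max 0 (Pstar pX W n (ell n) / D n - 1)) * mf *
    (logb #|X| n%:R / n%:R) =
  (1 + Num.max 0 (Pstar pX W n (ell n) / D n - 1)) * D n by rewrite /D; ring.
by rewrite -ler_pdivrMr ?D0 // -lerBlDl le_max lexx orbT.
Qed.
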